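(* Let $G$ be an abelian group and $A$ a subgroup of $G$. The following are equivalent: (a) $A\in \mathcal I\mathrm{soL}(G)$, i.e. $A$ is an isolated point of $\mathcal L(G)$ (equivalently, of $\ell\text{-}\mathcal L(G)$); (b) $A$ is divisible and $G=A\oplus B$ (internal direct sum) for some torsion-free subgroup $B$ of $G$; (c) $t(G)\le A\le d(G)$ and $A$ is divisible.
   Context: A ballean is a triple $(X,P,B)$ where $X,P$ are sets, $P\ne\emptyset$, and $B\colon X\times P\to\mathcal P(X)$ satisfies: $x\in B(x,\alpha)$; $x\in B(y,\alpha)$ iff $y\in B(x,\alpha)$; and for all $\alpha,\beta\in P$ there is $\gamma\in P$ such that $B(B(x,\alpha),\beta)\subseteq B(x,\gamma)$ for every $x\in X$, where $B(A,\delta)=\bigcup_{y\in A}B(y,\delta)$. The connected component of $x\in X$ is $\bigcup_{\alpha\in P}B(x,\alpha)$; the point $x$ is isolated if its connected component is $\{x\}$. For a group $G$, the finitary ballean is $\mathcal B_G=(G,[G]^{<\omega},B_G)$, where $[G]^{<\omega}$ is the family of finite subsets of $G$ and $B_G(x,F)=\{x\}\cup Fx\cup F^{-1}x$. Let $L(G)$ be the set of all subgroups of $G$. The subgroup exponential hyperballean $\mathcal L(G)$ is the ballean with support $L(G)$, set of radii $[G]^{<\omega}$, and balls $B_{\mathcal L(G)}(H,F)=\{K\in L(G): K\subseteq B_G(H,F),\ H\subseteq B_G(K,F)\}$. The subgroup logarithmic hyperballean $\ell\text{-}\mathcal L(G)$ is the ballean on $L(G)$ whose balls are the closed balls of radius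 $R\ge 0$ of the extended metric $d(H,K)=\log\max\{|H:H\cap K|,|K:H\cap K|\}$ if both indices are finite, and $d(H,K)=\infty$ otherwise. The balleans $\mathcal L(G)$ and $\ell\text{-}\mathcal L(G)$ have the same connected components, hence the same set of isolated points, denoted $\mathcal I\mathrm{soL}(G)$. For an abelian group $G$, $t(G)$ is its torsion subgroup and $d(G)$ its largest divisible subgroup. *)

(* Defs.v *)
From HB Require Import structures.
From mathcomp Require Import all_boot all_order all_algebra finmap.
From mathcomp Require Import mathcomp_extra boolp classical_sets functions.
From mathcomp Require Import cardinality reals ereal interval_inference exp.

Set Implicit Arguments.
Unset Strict Implicit.
Unset Printing Implicit Defensive.

Import Order.TTheory GRing.Theory Num.Theory.
Local Open Scope classical_set_scope.
Local Open Scope ring_scope.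

Definition bigball (X P : Type) (B : X -> P -> set X) (A : set X) (r : P) :
  set X := \bigcup_(y in A) B y r.

Record ballean := Ballean {
  support : Type;
  radius : Type;
  bball : support -> radius -> set support;
  radius_inhabited : inhabited radius;
  bball_center : forall x r, bball x r x;
  bball_sym : forall x y r, bball y r x <-> bball x r y;
  bball_upper : forall r s, exists t, forall x,
    bigball bball (bball x r) s `<=` bball x t }.

Arguments bball : clear implicits.

Definition component (X : ballean) (x : support X) : set (support X) :=
  \bigcup_(r in [set: radius X]) bball X x r.

Definition isolated_point (X : ballean) (x : support X) : Prop :=
  component x = [set x].

Arguments component : clear implicits.
Arguments isolated_point : clear implicits.

(* The subgroups of an abelian group G (written additively) are the elements of
   [zmodClosed G]; their membership predicates are boolean, but in the presence
   of classical choice every subset of G is of this form. *)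

Lemma zmodClosed_eq (G : zmodType) (H K : zmodClosed G) : H =i K -> H = K.
Proof.
case: H => H [[H1] [H2]]; case: K => K [[K1] [K2]] HK.
have {}HK : H = K by apply/funext => x; exact: HK.
case: _ / HK in K1 K2 *.
by rewrite (Prop_irrelevance K1 H1) (Prop_irrelevance K2 H2).
Qed.

Section Finitary.
Variable G : zmodType.

Definition finitary_ball (x : G) (F : {fset G}) : set G :=
  [set x] `|` [set f + x | f in [set` F]] `|` [set - f + x | f in [set` F]].

Let fball_trans (F : {fset G}) : seq G :=
  0 :: (enum_fset F ++ [seq - f | f <- enum_fset F]).

Let finitary_ballE x F y : finitary_ball x F y <-> y - x \in fball_trans F.
Proof.
rewrite /fball_trans inE mem_cat subr_eq0; split.
- case=> [[->|[f /= fF <-]]|[f /= fF <-]]; first by rewrite eqxx.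
  + by rewrite addrK fF orbT.
  + by rewrite addrK map_f ?orbT.
- case/or3P => [/eqP ->|yF|/mapP[f fF yE]]; first by left; left.
  + by left; right; exists (y - x); rewrite ?subrK.
  + by right; exists f => //=; rewrite -yE subrK.
Qed.

Let fball_transN F z : z \in fball_trans F -> - z \in fball_trans F.
Proof.
rewrite /fball_trans !inE !mem_cat oppr_eq0 => /or3P[->//|zF|/mapP[f fF ->]].
- by rewrite map_f // !orbT.
- by rewrite opprK fF orbT.
Qed.

Lemma finitary_ball_center x F : finitary_ball x F x.
Proof. by left; left. Qed.

Lemma finitary_ball_sym x y F : finitary_ball y F x <-> finitary_ball x F y.
Proof.
by split=> /finitary_ballE/fball_transN; rewrite opprB => /finitary_ballE.
Qed.

Lemma finitary_ballS x (E F : {fset G}) : {subset E <= F} ->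
  finitary_ball x E `<=` finitary_ball x F.
Proof.
move=> EF y [[->|[f /= /EF fF <-]]|[f /= /EF fF <-]].
- by left; left.
- by left; right; exists f.
- by right; exists f.
Qed.

Lemma finitary_ball_upper E F : exists D, forall x,
  bigball finitary_ball (finitary_ball x E) F `<=` finitary_ball x D.
Proof.
pose s := [seq e + f | e <- fball_trans E, f <- fball_trans F].
exists [fset g in s]%fset => x z.
case=> y /finitary_ballE yx /finitary_ballE zy; left; right.
exists (z - x); last by rewrite subrK.
rewrite /= in_fset; apply/allpairsP; exists (y - x, z - y); split=> //=.
by rewrite [RHS]addrC addrA subrK.
Qed.

Definition finitary_ballean : ballean := {|
  bball := finitary_ball;
  radius_inhabited := inhabits fset0;
  bball_center := finitary_ball_center;
  bball_sym := finitary_ball_sym;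
  bball_upper := finitary_ball_upper |}.

End Finitary.

Section SubgroupExponential.
Variable G : zmodType.

Definition exp_ball (H : zmodClosed G) (F : {fset G}) : set (zmodClosed G) :=
  [set K | [set` K] `<=` bigball (bball (finitary_ballean G)) [set` H] F /\
           [set` H] `<=` bigball (bball (finitary_ballean G)) [set` K] F].

Lemma exp_ball_center H F : exp_ball H F H.
Proof. by split=> x Hx; exists x => //; exact: finitary_ball_center. Qed.

Lemma exp_ball_sym H K F : exp_ball K F H <-> exp_ball H F K.
Proof. by split=> -[]. Qed.

Lemma exp_ball_upper E F : exists D, forall H,
  bigball exp_ball (exp_ball H E) F `<=` exp_ball H D.
Proof.
have [D1 BD1] := finitary_ball_upper E F.
have [D2 BD2] := finitary_ball_upper F E.
exists (D1 `|` D2)%fset => H L [K [KH HK] [LK KL]]; split=> x.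
- move=> /LK[y /KH[z Hz yz] xy]; exists z => //.
  apply: (@finitary_ballS _ _ D1); first by move=> u uD; rewrite inE uD.
  by apply: BD1; exists y.
- move=> /HK[y /KL[z Lz yz] xy]; exists z => //.
  apply: (@finitary_ballS _ _ D2); first by move=> u uD; rewrite inE uD orbT.
  by apply: BD2; exists y.
Qed.

Definition exp_hyperballean : ballean := {|
  bball := exp_ball;
  radius_inhabited := inhabits fset0;
  bball_center := exp_ball_center;
  bball_sym := exp_ball_sym;
  bball_upper := exp_ball_upper |}.

End SubgroupExponential.

Section SubgroupLogarithmic.
Variables (R : realType) (G : zmodType).

Definition cosets (H M : set G) : set (set G) :=
  [set [set x + m | m in M] | x in H].

(* The index |H : M|, meaningful only when [cosets H M] is finite; it is 0
   otherwise. *)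
Definition index (H M : set G) : nat := #|` fset_set (cosets H M)|.

Definition log_dist (H K : zmodClosed G) : \bar R :=
  let HK := [set` H] `&` [set` K] in
  if `[< finite_set (cosets [set` H] HK) /\ finite_set (cosets [set` K] HK) >]
  then (ln (maxn (index [set` H] HK) (index [set` K] HK))%:R)%:E
  else +oo%E.

Let coset_eq (M : zmodClosed G) (N : set G) (x y : G) :
  (N = [set` M]) -> [set x + m | m in N] = [set y + m | m in N] <-> x - y \in M.
Proof.
move=> ->; split=> [xy|Mxy].
- have : [set x + m | m in [set` M]] x by exists 0; rewrite /= ?rpred0 ?addr0.
  by rewrite xy => -[m /= Mm <-]; rewrite addrC addKr.
- apply/seteqP; split=> _ [m /= Mm <-].
  + by exists (x - y + m); [exact: rpredD | rewrite addrA [y + _]addrC subrK].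
  + exists (y - x + m); last by rewrite addrA [x + _]addrC subrK.
    by apply: rpredD => //; rewrite -opprB rpredN.
Qed.

Let capP (H K : zmodClosed G) :
  exists M : zmodClosed G, [set` H] `&` [set` K] = [set` M].
Proof.
have MP : zmod_closed [predI H & K].
  split=> [|x y]; rewrite !inE ?rpred0 // => /andP[? ?] /andP[? ?].
  by rewrite !rpredB.
pose M : zmodClosed G := HB.pack (fun x => x \in [predI H & K])
  (GRing.isZmodClosed.Build G (fun x => x \in [predI H & K]) MP).
by exists M; apply/seteqP; split=> x; [move=> [xH xK]; apply/andP | move=> /andP].
Qed.


Local Open Scope card_scope.

Let index_trans (H K L : zmodClosed G) :
  finite_set (cosets [set` H] ([set` H] `&` [set` K])) ->
  finite_set (cosets [set` K] ([set` K] `&` [set` L])) ->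
  finite_set (cosets [set` H] ([set` H] `&` [set` L])) /\
  (index [set` H] ([set` H] `&` [set` L]) <=
   index [set` H] ([set` H] `&` [set` K]) *
   index [set` K] ([set` K] `&` [set` L]))%N.
Proof.
have [HK HKE] := capP H K; have [KL KLE] := capP K L; have [HL HLE] := capP H L.
rewrite /index; set X := cosets _ _; set Y := cosets _ _; set Z := cosets _ _.
move=> finX finY.
pose rep (M : set G) (D : set G) : G :=
  xget 0 [set x | x \in H /\ [set x + m | m in M] = D].
have repP M D : cosets [set` H] M D ->
    rep M D \in H /\ [set rep M D + m | m in M] = D.
  by case=> x Hx xD; apply: (@xgetPex _ 0 [set x | x \in H /\ _]); exists x.
pose cK x := [set x + m | m in [set` H] `&` [set` K]].
pose g D := (cK (rep ([set` H] `&` [set` L]) D),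
  [set rep ([set` H] `&` [set` L]) D -
       rep ([set` H] `&` [set` K]) (cK (rep ([set` H] `&` [set` L]) D)) + m
   | m in [set` K] `&` [set` L]]).
have inHK D : Z D -> rep ([set` H] `&` [set` L]) D -
    rep ([set` H] `&` [set` K]) (cK (rep ([set` H] `&` [set` L]) D)) \in HK.
  move=> /repP[rH _]; have [|_] := repP ([set` H] `&` [set` K])
    (cK (rep ([set` H] `&` [set` L]) D)).
    by exists (rep ([set` H] `&` [set` L]) D).
  by move=> /(coset_eq _ _ HKE); rewrite -rpredN opprB.
have gP : set_fun Z (X `*` Y) g.
  move=> D ZD; have [rH _] := repP _ _ ZD; split=> /=.
    by exists (rep ([set` H] `&` [set` L]) D).
  have := inHK D ZD; set u := _ - _ => uHK; exists u => //.
  suff : ([set` H] `&` [set` K]) u by case.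
  by rewrite HKE.
have ginj : set_inj Z g.
  move=> D D' /set_mem ZD /set_mem ZD' [e1 /(coset_eq _ _ KLE)].
  rewrite e1 opprB addrA subrK => kl.
  have [rH eD] := repP _ _ ZD; have [rH' eD'] := repP _ _ ZD'.
  rewrite -eD -eD'; apply/(coset_eq _ _ HLE).
  suff : [set` HL] (rep ([set` H] `&` [set` L]) D -
                    rep ([set` H] `&` [set` L]) D') by [].
  rewrite -HLE; split; first by rewrite /= rpredB.
  suff : ([set` K] `&` [set` L]) (rep ([set` H] `&` [set` L]) D -
                    rep ([set` H] `&` [set` L]) D') by case.
  by rewrite KLE.
have ZXY : Z #<= X `*` Y.
  have [f] : $|{injfun Z >-> X `*` Y}| by apply/injfunPex; exists g.
  exact: inj_card_le f.
have finXY : finite_set (X `*` Y) by exact: finite_setX.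
split; first exact: card_le_finite ZXY finXY.
have [n XYn] := finXY.
apply: (@leq_trans n).
  by apply: geq_card_fset_set; rewrite -(card_le_eqr XYn).
rewrite -(card_fset_set XYn) fset_setX // -(size_allpairs pair).
apply: uniq_leq_size; first exact: fset_uniq.
move=> [x y]; rewrite in_fsetM /= => /andP[? ?].
by apply/allpairsP; exists (x, y).
Qed.

Let index_gt0 (H : zmodClosed G) (M : set G) :
  finite_set (cosets [set` H] M) -> (0 < index [set` H] M)%N.
Proof.
move=> fH; rewrite /index cardfs_gt0; apply/fset0Pn.
exists [set 0 + m | m in M]; rewrite in_fset_set // inE.
by exists 0 => //=; exact: rpred0.
Qed.

Lemma log_dist_sym H K : log_dist H K = log_dist K H.
Proof. by rewrite /log_dist /= setIC maxnC andC. Qed.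

Lemma log_dist_refl H : log_dist H H = 0%E.
Proof.
rewrite /log_dist /index setIid.
have -> : cosets [set` H] [set` H] = [set [set` H]].
  have H0 : [set 0 + m | m in [set` H]] = [set` H].
    by apply/seteqP; split=> x /=; [case=> y yH <-|move=> xH; exists x];
      rewrite ?add0r.
  apply/seteqP; split=> [_ [x xH <-]|_ ->] /=.
    by rewrite -[RHS]H0; apply/(coset_eq _ _ erefl); rewrite subr0.
  by exists 0; rewrite /= ?rpred0.
rewrite asboolT; last by split; exact: finite_set1.
by rewrite maxnn fset_set1 cardfs1 ln1.
Qed.

Lemma log_dist_triangle H K L :
  (log_dist H L <= log_dist H K + log_dist K L)%E.
Proof.
have ln_ge0 (a b : nat) : (0 < a)%N -> (0 <= (ln (maxn a b)%:R : R))%R.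
  by move=> a0; apply: ln_ge0; rewrite ler1n leq_max a0.
have dist_gtNy H' K' : log_dist H' K' != -oo%E.
  by rewrite /log_dist; case: asboolP.
have [->|] := eqVneq (log_dist H K) +oo%E; first by rewrite addye // leey.
have [->|] := eqVneq (log_dist K L) +oo%E; first by rewrite addey // leey.
rewrite /log_dist; case: (asboolP (_ /\ _)) => // -[fKL fLK] _.
case: (asboolP (_ /\ _)) => // -[fHK fKH] _.
have [fHL leHL] := index_trans fHK fKL.
rewrite setIC in fLK; rewrite [X in cosets _ X]setIC in fKH.
have [fLH leLH] := index_trans fLK fKH.
rewrite asboolT; last by split=> //; rewrite setIC.
have HK0 := index_gt0 fHK; have KL0 := index_gt0 fKL; have HL0 := index_gt0 fHL.
have max0 a b : (0 < a)%N -> (0 < (maxn a b)%:R :> R).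
  by move=> a0; rewrite ltr0n leq_max a0.
rewrite -EFinD lee_fin -lnM ?posrE ?max0 // -natrM ler_ln ?posrE ?max0 //; last first.
  by rewrite ltr0n muln_gt0 !leq_max HK0 KL0.
rewrite ler_nat geq_max; apply/andP; split.
  by apply: (leq_trans leHL); apply: leq_mul; rewrite leq_max leqnn.
rewrite [X in index _ X]setIC; apply: (leq_trans leLH); rewrite mulnC.
by apply: leq_mul; rewrite leq_max [X in index _ X]setIC leqnn orbT.
Qed.

Definition log_ball (H : zmodClosed G) (r : {nonneg R}) : set (zmodClosed G) :=
  [set K | (log_dist H K <= r%:num%:E)%E].

Lemma log_ball_center H r : log_ball H r H.
Proof. by rewrite /log_ball /= log_dist_refl lee_fin. Qed.

Lemma log_ball_sym H K r : log_ball K r H <-> log_ball H r K.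
Proof. by rewrite /log_ball /= log_dist_sym. Qed.

Lemma log_ball_upper r s : exists t, forall H,
  bigball log_ball (log_ball H r) s `<=` log_ball H t.
Proof.
exists (r%:num + s%:num)%:nng => H L [K HK KL].
by apply: le_trans (log_dist_triangle H K L) _; rewrite EFinD; exact: leeD.
Qed.

Definition log_hyperballean : ballean := {|
  bball := log_ball;
  radius_inhabited := inhabits 0%:nng;
  bball_center := log_ball_center;
  bball_sym := log_ball_sym;
  bball_upper := log_ball_upper |}.

End SubgroupLogarithmic.

Section DivisibleTorsion.
Variable G : zmodType.

Definition divisible (A : zmodClosed G) : Prop :=
  forall n : nat, (0 < n)%N ->
    forall a, a \in A -> exists2 b, b \in A & b *+ n = a.

Definition torsion : set G := [set x | exists2 n : nat, (0 < n)%N & x *+ n = 0].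

Definition torsion_free (B : zmodClosed G) : Prop :=
  [set` B] `&` torsion `<=` [set 0].

Definition direct_sum (A B : zmodClosed G) : Prop :=
  [set a + b | a in [set` A] & b in [set` B]] = [set: G] /\
  [set` A] `&` [set` B] = [set 0].

(* The union of all divisible subgroups; it is itself a divisible subgroup, see
   [max_divisibleP]. *)
Definition max_divisible : set G :=
  \bigcup_(D in [set D : zmodClosed G | divisible D]) [set` D].

Lemma torsionP : exists T : zmodClosed G, [set` T] = torsion.
Proof.
have TP : zmod_closed [pred x | `[< torsion x >]].
  split=> [|x y]; rewrite !inE.
    by exists 1%N => //; rewrite mul0rn.
  move=> [m m0 xm] [n n0 yn].
  exists (m * n)%N; first by rewrite muln_gt0 m0.
  by rewrite mulrnBl mulrnA xm mulnC mulrnA yn !mul0rn subr0.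
pose T : zmodClosed G := HB.pack (fun x => x \in [pred x | `[< torsion x >]])
  (GRing.isZmodClosed.Build G (fun x => x \in [pred x | `[< torsion x >]]) TP).
by exists T; apply/seteqP; split=> x /asboolP.
Qed.

Lemma max_divisibleP : exists D : zmodClosed G,
  [/\ [set` D] = max_divisible, divisible D &
      forall E : zmodClosed G, divisible E -> {subset E <= D}].
Proof.
have addD (E F : zmodClosed G) : divisible E -> divisible F ->
    exists2 D : zmodClosed G, divisible D &
      forall x y, x \in E -> y \in F -> x - y \in D.
  move=> dE dF; pose S := [pred x | `[< exists2 e, e \in E & x - e \in F >]].
  have SP : zmod_closed S.
    split=> [|x y]; rewrite !inE.
      by exists 0; rewrite ?subr0 rpred0.
    move=> [e eE xe] [f fE yf].
    exists (e - f); first exact: rpredB.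
    by rewrite opprD addrACA -opprD rpredB.
  pose D : zmodClosed G := HB.pack (fun x => x \in S)
    (GRing.isZmodClosed.Build G (fun x => x \in S) SP).
  exists D => [n n0 x /asboolP[e eE xeF]|x y xE yF].
    have [e' eE' e'E] := dE n n0 e eE; have [f' fF' f'E] := dF n n0 _ xeF.
    exists (e' + f'); last by rewrite mulrnDl e'E f'E addrC subrK.
    by apply/asboolP; exists e'; rewrite // addrC addKr.
  by apply/asboolP; exists x => //; rewrite addrC addKr rpredN.
have MP : zmod_closed [pred x | `[< max_divisible x >]].
  split=> [|x y]; rewrite !inE.
    have zP : zmod_closed (pred1 (0 : G)).
      by split=> [|x y]; rewrite !inE // => /eqP-> /eqP->; rewrite subr0.
    pose Z : zmodClosed G := HB.pack (fun x => x \in pred1 (0 : G))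
      (GRing.isZmodClosed.Build G (fun x => x \in pred1 (0 : G)) zP).
    exists Z; last exact: eqxx.
    by move=> n _ a /eqP->; exists 0; rewrite ?mul0rn ?rpred0.
  move=> [E dE xE] [F dF yF].
  by have [D dD sD] := addD E F dE dF; exists D => //; exact: sD.
pose M : zmodClosed G := HB.pack (fun x => x \in [pred x | `[< max_divisible x >]])
  (GRing.isZmodClosed.Build G (fun x => x \in [pred x | `[< max_divisible x >]]) MP).
exists M; split.
- by apply/seteqP; split=> x /asboolP.
- move=> n n0 x /asboolP[E dE xE]; have [y yE yx] := dE n n0 x xE.
  by exists y => //; apply/asboolP; exists E.
- by move=> E dE x xE; apply/asboolP; exists E.
Qed.

End DivisibleTorsion.

Arguments torsion : clear implicits.
Arguments max_divisible : clear implicits.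

(* Main.v *)
Require Import Defs.
From HB Require Import structures.
From mathcomp Require Import all_boot all_algebra.
From mathcomp Require Import finmap boolp classical_sets cardinality.
From mathcomp Require Import reals ereal interval_inference.
Set Implicit Arguments.
Unset Strict Implicit.
Unset Printing Implicit Defensive.

Import GRing.Theory Num.Theory.
Local Open Scope classical_set_scope.

(** The two hyperballeans are compared with one relation: H is almost contained
    in K when H is covered by finitely many cosets of K, and two subgroups are
    commensurable when each is almost contained in the other. In the subgroup
    exponential hyperballean and in the logarithmic one, the connected component
    of A consists of the subgroups commensurable with A
    ([exp_component_commensurable], [log_component_commensurable]), because
    a finite set of translations, a finite set of coset representatives and the
    finiteness of an index carry the same information. So in both balleans A is
    isolated exactly when no other subgroup is commensurable with A.

    Let A be isolated. If some a in A were not in pA for a prime p, a subgroup M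
    maximal among those containing pA and avoiding a would meet A in a proper
    subgroup of finite index ([isolated_prime_divisible]); hence A is divisible.
    If b is a torsion element, A has finite index in the subgroup generated by A
    and b, so b lies in A ([isolated_torsion_sub]). A divisible subgroup has
    a complement ([divisible_complement]), and this complement is torsion-free
    as soon as A contains the torsion.

    Conversely let A be divisible and contain the torsion. When H is almost
    contained in K, the pigeonhole principle applied to the multiples of the
    elements of H gives n > 0 with nH inside K ([almost_contained_multiple]).
    For K commensurable with A this yields A = mA inside K, and nK inside A = nA;
    so each x in K differs from an element of A by an element killed by n, and
    K is inside A. *)

(** * Subgroups: constructions, maximal ones, complements of divisible ones *)

Section Subgroups.
Local Open Scope ring_scope.
Variable G : zmodType.
Implicit Types H K M A B : zmodClosed G.

(** Subgroups are boolean predicates carrying closure proofs; this packages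
    a propositional description of a subgroup once and for all. *)
Lemma subgroup_of (S : set G) :
  S 0 -> (forall x y, S x -> S y -> S (x - y)) ->
  exists H, forall x, x \in H <-> S x.
Proof.
move=> S0 SB.
have SP : zmod_closed [pred x | `[< S x >]].
  split=> [|x y]; rewrite !inE //; exact: SB.
pose H : zmodClosed G := HB.pack (fun x => x \in [pred x | `[< S x >]])
  (GRing.isZmodClosed.Build G (fun x => x \in [pred x | `[< S x >]]) SP).
by exists H => x; split=> /asboolP.
Qed.

Lemma sum_subgroup A B : exists C : zmodClosed G,
  forall x, x \in C <-> exists2 a, a \in A & x - a \in B.
Proof.
apply: subgroup_of => [|x y [a aA xa] [b bA yb]].
  by exists 0; rewrite ?subr0 rpred0.
by exists (a - b); [rewrite rpredB | rewrite opprD addrACA -opprD rpredB].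
Qed.

Lemma cyclic_sum_subgroup A x : exists C : zmodClosed G,
  forall y, y \in C <-> exists k : int, y - x *~ k \in A.
Proof.
apply: subgroup_of => [|y z [k yA] [l zA]].
  by exists 0; rewrite mulr0z subr0 rpred0.
by exists (k - l); rewrite mulrzBr opprD addrACA -opprD rpredB.
Qed.

Lemma cap_subgroup A B : exists C : zmodClosed G,
  forall x, x \in C <-> x \in A /\ x \in B.
Proof.
by apply: subgroup_of => [|x y [xA xB] [yA yB]]; rewrite ?rpred0 ?rpredB.
Qed.

(** Zorn's lemma, with maximality read off on the subgroup generated by M and
    one new element x, whose elements are the m + kx. *)
Lemma maximal_avoiding (S : zmodClosed G) (T : set G) :
  (forall x, x \in S -> ~ T x) ->
  exists M, [/\ {subset S <= M}, forall x, x \in M -> ~ T x &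
    forall x, x \notin M -> exists m (k : int), m \in M /\ T (m + x *~ k)].
Proof.
move=> ST.
(* Zorn's lemma is applied to the X such that the union of S and X is a
   subgroup, rather than to the subgroups themselves, so that the union of the
   empty chain, which is empty, is admissible. *)
pose P (X : set G) := exists M : zmodClosed G,
  (forall x, x \in M <-> x \in S \/ X x) /\ forall x, x \in M -> ~ T x.
have [F FP totF|X [[M [MX MT]] Xmax]] := @Zorn_bigcup _ P.
  have [M MF] : exists M : zmodClosed G,
      forall x, x \in M <-> x \in S \/ (\bigcup_(X in F) X) x.
    apply: subgroup_of => [|x y]; first by left; rewrite rpred0.
    have inF X z : F X -> (z \in S \/ X z) -> z \in S \/ (\bigcup_(X in F) X) z.
      by move=> FX [|Xz]; [left | right; exists X].
    have one X : F X -> (x \in S \/ X x) -> (y \in S \/ X y) ->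
        x - y \in S \/ (\bigcup_(X in F) X) (x - y).
      move=> FX xX yX; apply: (inF X) => //; have [M [MX _]] := FP _ FX.
      by apply/MX; rewrite rpredB //; apply/MX.
    move=> [xS|[X FX Xx]] [yS|[Y FY Yy]].
    - by left; rewrite rpredB.
    - by apply: (one Y) => //; [left | right].
    - by apply: (one X) => //; [right | left].
    - by have [XY|YX] := totF X Y FX FY; [apply: (one Y) | apply: (one X)] => //;
        right => //; [exact: XY | exact: YX].
  exists M; split=> // x /MF[/ST //|[X FX Xx]].
  by have [N [NX NT]] := FP _ FX; apply: NT; apply/NX; right.
exists M; split=> // [x xS|x xM]; first by apply/MX; left.
apply: contrapT => xT.
have [C CE] := cyclic_sum_subgroup M x.
have MC y : y \in M -> y \in C.
  by move=> yM; apply/CE; exists 0; rewrite mulr0z subr0.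
apply: (Xmax [set` C]); last first.
  exists C; split=> [y|y /CE[k yM] Ty]; last first.
    by apply: xT; exists (y - x *~ k), k; rewrite subrK.
  split=> [yC|[yS|//]]; first by right.
  by apply: MC; apply/MX; left.
split=> [y Xy|CX]; first by apply: MC; apply/MX; right.
move/negP: xM; apply; apply/MX; right; apply: CX; apply/CE.
by exists 1; rewrite mulr1z subrr rpred0.
Qed.

(** Divisible subgroups are direct summands. Let B be maximal with A and B
    meeting only in 0. If g is not in A + B, let k > 0 be minimal with kg in
    A + B. Dividing the A-component of kg by k, and subtracting the quotient
    from g, moves kg into B. By maximality, B and the new g generate a subgroup
    meeting A in a nonzero b + lg; then lg is in A + B, so k divides l and lg
    is in B, hence b + lg is in both A and B. *)
Lemma divisible_complement A : divisible A -> exists B, direct_sum A B.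
Proof.
move=> dA.
have [Z ZE] : exists Z : zmodClosed G, forall x, x \in Z <-> x = 0.
  by apply: subgroup_of => // x y -> ->; rewrite subr0.
have [|B [_ BA Bmax]] := @maximal_avoiding Z [set x | x \in A /\ x <> 0].
  by move=> x /ZE -> [_].
have AB0 x : x \in A -> x \in B -> x = 0.
  by move=> xA xB; apply: contrapT => x0; apply: BA xB _.
have [C CE] := sum_subgroup A B.
have AC x : x \in A -> x \in C.
  by move=> xA; apply/CE; exists x; rewrite ?subrr ?rpred0.
have BC x : x \in B -> x \in C.
  by move=> xB; apply/CE; exists 0; rewrite ?subr0 ?rpred0.
have meets x : x \notin C -> exists k : int,
    exists b, [/\ b \in B, b + x *~ k \in A, b + x *~ k <> 0 & x *~ k \in C].
  move=> xC; have [|b [k [bB [xA x0]]]] := Bmax x.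
    by apply: contra xC; exact: BC.
  exists k, b; split=> //.
  by rewrite -(addKr b (x *~ k)) addrC; apply: rpredB; [exact: AC | exact: BC].
suff CT g : g \in C.
  exists B; split.
    apply/seteqP; split=> // g _; have /CE[a aA gaB] := CT g.
    by exists a => //; exists (g - a) => //; rewrite addrC subrK.
  apply/seteqP; split=> [x [xA xB]|_ ->]; first exact: AB0.
  by split; exact: rpred0.
apply: contrapT => /negP gC.
have exk : exists k, (0 < k)%N && (g *+ k \in C).
  have [k [b [bB xA x0 xC]]] := meets _ gC.
  exists `|k|%N; apply/andP; split.
    rewrite absz_gt0; apply/eqP => k0; apply: x0.
    by apply: AB0 => //; rewrite k0 mulr0z addr0.
  by rewrite pmulrn abszE; case: (ger0P k) => _; rewrite ?mulrNz ?rpredN.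
case: (ex_minnP exk) => k /andP[k0 /CE[a aA gaB]] kmin.
have [a' a'A a'E] := dA k k0 a aA.
pose x := g - a'.
have xkB : x *+ k \in B by rewrite mulrnBl a'E.
have gxC (l : int) : (x *~ l \in C) = (g *~ l \in C).
  by rewrite /x mulrzBl rpredBr // AC // rpredMz.
have [|l [b [bB xA x0]]] := meets x; first by rewrite -(mulr1z x) gxC mulr1z.
rewrite gxC => glC; apply: x0; apply: AB0 => //.
suff /dvdzP[q ->] : (k %| l)%Z.
  by rewrite rpredD // mulrC mulrzA rpredMz.
have kN0 : k%:Z != 0 by rewrite eqz_nat -lt0n.
have : g *~ (l %% k)%Z \in C.
  rewrite /modz mulrzBr rpredB // mulrC mulrzA rpredMz //.
  by apply/CE; exists a.
rewrite (sameP dvdz_mod0P eqP).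
have := modz_ge0 l kN0; have := ltz_pmod l (d := k) k0.
case: (l %% k)%Z => // r rk _ rC; rewrite eqz_nat -leqn0 leqNgt.
apply/negP => r0; have := kmin r; rewrite r0 rC => /(_ isT).
by rewrite leqNgt -ltz_nat rk.
Qed.

End Subgroups.

(** * Components of the hyperballeans and commensurability *)

Lemma isolated_pointP (X : ballean) (A : Defs.support X)
    (r : Defs.support X -> Prop) :
  (forall K, component X A K <-> r K) ->
  (isolated_point X A <-> forall K, r K -> K = A).
Proof.
move=> XE; split=> [iA K /XE|rA]; first by rewrite iA.
apply/seteqP; split=> [K /XE/rA //|_ ->].
by case: (radius_inhabited X) => s; exists s => //; exact: bball_center.
Qed.

Section Commensurability.
Local Open Scope ring_scope.
Variable G : zmodType.
Implicit Types H K M A B : zmodClosed G.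

Definition almost_contained H K := exists s : seq G,
  forall x, x \in H -> exists2 y, y \in s & x - y \in K.

Definition commensurable H K := almost_contained H K /\ almost_contained K H.

Lemma sub_almost_contained H K : {subset H <= K} -> almost_contained H K.
Proof.
by move=> HK; exists [:: 0] => x xH; exists 0; rewrite ?mem_head ?subr0 ?HK.
Qed.

(** Modulo K the multiples of x reduce to the finitely many ix with i < n. *)
Lemma cyclic_almost_contained H K x n : (0 < n)%N -> x *+ n \in K ->
  (forall y, y \in H -> exists k : int, y - x *~ k \in K) ->
  almost_contained H K.
Proof.
move=> n0 xnK Hx; exists [seq x *+ i | i <- iota 0 n] => y /Hx[k ykK].
have nN0 : n%:Z != 0 by rewrite eqz_nat -lt0n.
have := modz_ge0 k nN0; have := ltz_pmod k (d := n) n0.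
have := divz_eq k n; case: (k %% n)%Z => // r kE rn _.
exists (x *+ r).
  by apply/mapP; exists r => //; rewrite mem_iota -ltz_nat.
rewrite -(subrKA (x *~ k)) rpredD //.
by rewrite kE mulrzDr mulrC mulrzA addrK rpredMz.
Qed.

(** Among the multiples 0, x, ..., Nx of x, where N is the number of cosets that
    cover H, two lie in the same coset of K; so ix is in K for some i with
    0 < i <= N, and N! works for all x at once. *)
Lemma almost_contained_multiple H K : almost_contained H K ->
  exists2 n, (0 < n)%N & forall x, x \in H -> x *+ n \in K.
Proof.
case=> s sP; exists (size s)`!; first exact: fact_gt0.
move=> x xH.
have /choice[f fP] (i : 'I_(size s).+1) :
    exists j : 'I_(size s), x *+ i - s`_j \in K.
  have [|y ys xyK] := sP (x *+ i); first exact: rpredMn.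
  by exists (Ordinal (etrans (index_mem _ _) ys)); rewrite /= nth_index.
have /injectivePn[i [j ij fij]] : ~~ injectiveb f.
  apply/negP => /injectiveP/leq_card; rewrite !card_ord.
  by rewrite ltnn.
wlog {ij} ij : i j fij / (i < j)%N.
  by move=> W; case: (ltngtP i j) ij => [? _|? _|/val_inj ->];
    [exact: (W i j) | exact: (W j i) | rewrite eqxx].
have xK : x *+ (j - i) \in K.
  rewrite mulrnBr ?(ltnW ij) //.
  rewrite -[_ - _](subrKA s`_(f i)) {1}fij -[s`_(f i) - _]opprB.
  by rewrite rpredB.
have /dvdnP[q ->] : (j - i %| (size s)`!)%N.
  apply: dvdn_fact; rewrite subn_gt0 ij /=.
  by apply: leq_trans (leq_subr _ _) _; rewrite -ltnS.
by rewrite mulnC mulrnA rpredMn.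
Qed.

(** A radius F translates the subgroup by 0, F and -F, hence covers by finitely
    many cosets; in the other direction, coset representatives form a radius. *)
Lemma exp_component_commensurable A K :
  component (exp_hyperballean G) A K <-> commensurable A K.
Proof.
have ballP (F : {fset G}) H x : bigball (bball (finitary_ballean G)) [set` H] F x ->
    exists2 y, y \in 0 :: enum_fset F ++ [seq - f | f <- enum_fset F] & x - y \in H.
  case=> y yH; rewrite /= /finitary_ball => -[[->|[f /= fF <-]]|[f /= fF <-]].
  - by exists 0; rewrite ?mem_head ?subr0.
  - by exists f; rewrite ?inE ?mem_cat ?fF ?orbT // addrC addKr.
  - exists (- f); rewrite ?inE ?mem_cat ?map_f ?orbT //.
    by rewrite addrC addKr.
split=> [[F _ [KA AK]]|[[s sP] [t tP]]].
  by split; eexists=> x xH; apply: ballP; [exact: AK | exact: KA].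
exists [fset x in s ++ t]%fset => //; split=> x xH.
- have [y yt xy] := tP _ xH; exists (x - y) => //; left; right.
  by exists y; rewrite /= ?in_fset ?mem_cat ?yt ?orbT // addrC subrK.
- have [y yt xy] := sP _ xH; exists (x - y) => //; left; right.
  by exists y; rewrite /= ?in_fset ?mem_cat ?yt // addrC subrK.
Qed.

(** The map from H modulo its intersection with K to G modulo K is injective.
    The cosets covering H may be represented by elements outside H, so that
    representatives must be chosen again inside H in one direction. *)
Lemma finite_cosetsP H K :
  finite_set (cosets [set` H] ([set` H] `&` [set` K])) <-> almost_contained H K.
Proof.
have [M ME] := cap_subgroup H K.
have -> : [set` H] `&` [set` K] = [set` M].
  by apply/seteqP; split=> x; [move=> [? ?]; apply/ME | move=> /ME].
split=> [/finite_image fin|[s sP]].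
  have [s sE] := (finite_seqP _).1 (fin _ (fun D : set G => xget 0 D)).
  exists s => x xH; pose D := [set x + m | m in [set` M]].
  exists (xget 0 D).
    suff : [set` s] (xget 0 D) by [].
    by rewrite -sE; exists D => //; exists x.
  have : D (xget 0 D).
    by apply: (xgetPex 0); exists x; exists 0; rewrite ?addr0 //=; exact: rpred0.
  by case=> m /= /ME[_ mK] <-; rewrite opprD addNKr rpredN.
(* An element of H in the same coset of K as y, if there is one. *)
pose pick y := xget 0 [set h | h \in H /\ h - y \in K].
pose coset_pick y := [set pick y + m | m in [set` M]].
apply: (@sub_finite_set _ _ (coset_pick @` [set` s])); last first.
  by apply: finite_image; apply/finite_seqP; exists s.
move=> _ [x xH <-]; have [y ys xyK] := sP x xH; exists y => //.
have [pH pK] : pick y \in H /\ pick y - y \in K.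
  by apply: (@xgetPex _ 0 [set h | h \in H /\ h - y \in K]); exists x.
have pxM : pick y - x \in M.
  apply/ME; split; first exact: rpredB.
  by rewrite -(subrKA y) -[y - x]opprB rpredB.
apply/seteqP; split=> _ [m /= mM <-].
  by exists (pick y - x + m); [exact: rpredD | rewrite addrA [x + _]addrC subrK].
exists (m - (pick y - x)); first exact: rpredB.
by rewrite opprB addrCA addrC [pick y + _]addrC subrK addrC.
Qed.

Lemma log_component_commensurable (R : realType) A K :
  component (log_hyperballean R G) A K <-> commensurable A K.
Proof.
rewrite /commensurable -!finite_cosetsP [X in cosets [set` K] X]setIC.
split=> [[r _]|fin].
  by rewrite /= /log_ball /= /log_dist; case: asboolP.
pose l : R := exp.ln (maxn (Defs.index [set` A] ([set` A] `&` [set` K]))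
  (Defs.index [set` K] ([set` A] `&` [set` K])))%:R.
exists `|l|%:nng => //.
by rewrite /= /log_ball /= /log_dist; case: asboolP => // _; rewrite lee_fin ler_norm.
Qed.

End Commensurability.

(** * Subgroups that are commensurable only with themselves *)

Section Isolated.
Local Open Scope ring_scope.
Variables (G : zmodType) (A : zmodClosed G).

Hypothesis isoA : forall K : zmodClosed G, commensurable A K -> K = A.

(** Let M be maximal among the subgroups containing pA and avoiding a. Each x in
    A outside M satisfies a = m + kx with m in M; here k is prime to p, since
    px is in M and a is not, so modulo M the element x is a multiple of a.
    Hence the intersection of A and M has index at most p in A. *)
Lemma isolated_prime_divisible p a : prime p -> a \in A ->
  exists2 b, b \in A & b *+ p = a.
Proof.
move=> pp aA; apply: contrapT => pa.
have [S SE] : exists S : zmodClosed G,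
    forall x, x \in S <-> exists2 b, b \in A & b *+ p = x.
  apply: subgroup_of => [|x y [b bA <-] [c cA <-]].
    by exists 0; rewrite ?rpred0 ?mul0rn.
  by exists (b - c); rewrite ?mulrnBl // rpredB.
have [|M [SM aM Mmax]] := @maximal_avoiding _ S [set a].
  by move=> x /SE xS xa; apply: pa; rewrite -xa.
have [N NE] := cap_subgroup A M.
have pM x : x \in A -> x *+ p \in M.
  by move=> xA; apply: SM; apply/SE; exists x.
suff AN : commensurable A N.
  have : a \in N by rewrite (isoA AN).
  by move=> /NE[_ /aM]; apply.
split; last by apply: sub_almost_contained => x /NE[].
apply: (@cyclic_almost_contained _ _ _ a p).
- exact: prime_gt0.
- by apply/NE; split; [exact: rpredMn | exact: pM].
move=> x xA; have [xM|/Mmax[m [k [mM aE]]]] := boolP (x \in M).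
  by exists 0; rewrite mulr0z subr0; apply/NE.
(* If k = qp then kx = q(px) is in M, and so is a = m + kx. *)
have pk : coprimez p k.
  rewrite coprimezE /= prime_coprime //; apply/negP => pk.
  have /dvdzP[q kE] : (p %| k)%Z by rewrite /dvdz.
  apply: (aM _ _ aE); rewrite rpredD // kE mulrC mulrzA rpredMz //.
  exact: pM.
have /coprimezP[[u v] /= uv] := pk.
exists v; apply/NE; split; first by rewrite rpredB // rpredMz.
(* From up + vk = 1 and a = m + kx: x - va = u(px) - vm. *)
have -> : x - a *~ v = (x *+ p) *~ u - m *~ v.
  rewrite -{1}(mulr1z x) -uv mulrzDr -aE mulrzDl [u * _]mulrC [v * _]mulrC.
  by rewrite !mulrzA opprD addrACA subrr addr0.
by rewrite rpredB // rpredMz // pM.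
Qed.

Lemma isolated_divisible : divisible A.
Proof.
elim/ltn_ind => n IH n0 a aA.
have [n1|n1] := leqP n 1.
  by exists a => //; rewrite (_ : n = 1%N) //; apply/eqP; rewrite eqn_leq n1.
have pp := pdiv_prime n1.
have [b bA <-] := isolated_prime_divisible pp aA.
have [||c cA <-] := IH (n %/ pdiv n)%N _ _ b bA.
- by rewrite ltn_Pdiv // prime_gt1.
- by rewrite divn_gt0 ?pdiv_gt0 // dvdn_leq // pdiv_dvd.
by exists c => //; rewrite -mulrnA divnK // pdiv_dvd.
Qed.

(** If nb = 0 with n > 0, the subgroup generated by A and b is covered by the
    cosets of 0, b, ..., (n - 1)b modulo A. *)
Lemma isolated_torsion_sub : torsion G `<=` [set` A].
Proof.
move=> b [n n0 bn].
have [K KE] := cyclic_sum_subgroup A b.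
have AK x : x \in A -> x \in K.
  by move=> xA; apply/KE; exists 0; rewrite mulr0z subr0.
rewrite /= -(isoA (K := K)); first by apply/KE; exists 1; rewrite mulr1z subrr rpred0.
split; first exact: sub_almost_contained.
apply: (@cyclic_almost_contained _ _ _ b n) => //; first by rewrite bn rpred0.
by move=> y /KE.
Qed.

End Isolated.

Lemma divisible_torsion_sub_isolated (G : zmodType) (A K : zmodClosed G) :
  torsion G `<=` [set` A] -> divisible A -> commensurable A K -> K = A.
Proof.
move=> tA dA [/almost_contained_multiple[m m0 AK]].
move=> /almost_contained_multiple[n n0 KA].
apply: zmodClosed_eq => x; apply/idP/idP => [xK|xA]; last first.
  by have [y yA <-] := dA m m0 x xA; exact: AK.
have [y yA yx] := dA n n0 _ (KA x xK).
rewrite -(subrK y x) rpredD //; apply: tA; exists n => //.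
by rewrite mulrnBl yx subrr.
Qed.

Theorem proposition3p6 (R : realType) (G : zmodType) (A : zmodClosed G) :
  [<-> isolated_point (exp_hyperballean G) A;
       isolated_point (log_hyperballean R G) A;
       divisible A /\
         (exists2 B : zmodClosed G, torsion_free B & direct_sum A B);
       [/\ torsion G `<=` [set` A], [set` A] `<=` max_divisible G
         & divisible A]].
Proof.
have expE := isolated_pointP (X := exp_hyperballean G)
  (exp_component_commensurable A).
have logE := isolated_pointP (X := log_hyperballean R G)
  (log_component_commensurable R A).
tfae.
- by move=> /expE isoA; apply/logE.
- move=> /logE isoA; have dA := isolated_divisible isoA.
  split=> //; have [B AB] := divisible_complement dA; exists B => //.
  by rewrite /torsion_free => x [xB /(isolated_torsion_sub isoA) xA]; case: AB => _ <-.
- move=> [dA [B tB [AB AB0]]]; split=> //; last by move=> x xA; exists A.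
  move=> x [n n0 xn].
  have [a aA [b bB xE]] : [set a + b | a in [set` A] & b in [set` B]]%R x.
    by rewrite AB.
  have bA : (b *+ n \in A)%R.
    by rewrite -(addKr (a *+ n) (b *+ n))%R -mulrnDl xE xn addr0 rpredN rpredMn.
  have bn0 : (b *+ n = 0)%R.
    suff : ([set` A] `&` [set` B]) (b *+ n)%R by rewrite AB0.
    by split=> //; exact: rpredMn.
  have b0 : b = 0%R by apply: tB; split=> //; exists n.
  by rewrite -xE b0 addr0.
- move=> [tA _ dA]; apply/expE => K.
  exact: divisible_torsion_sub_isolated.
Qed.
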